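(* Let $G=(V,E)$ be a graph with countably infinite vertex set. The following are equivalent: (1) For every partition of $V$ into two infinite sets $V_1,V_2$, there exist $W_1\subseteq V_1$ and $W_2\subseteq V_2$ such that for $i=1,2$ every $v\in W_i$ has infinite degree in the induced subgraph $G[W_i]$, and there is an edge $w_1w_2\in E$ with $w_1\in W_1$, $w_2\in W_2$. (2) For every labeling of $V$ by $\mathbb{Z}$ there exists an infinite increasing two-sided path in $G$.
   Context: A labeling of $V$ by $\mathbb{Z}$ is a bijection $\phi:V\to\mathbb{Z}$. An infinite increasing two-sided path is a family of distinct vertices $(v_i)_{i\in\mathbb{Z}}$ with $v_iv_{i+1}\in E$ and $\phi(v_i)<\phi(v_{i+1})$ for all $i\in\mathbb{Z}$. *)

(* Defs.v *)
From mathcomp Require Import all_boot all_order all_algebra.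
From mathcomp Require Import boolp classical_sets functions cardinality.

Set Implicit Arguments.
Unset Strict Implicit.
Unset Printing Implicit Defensive.

Import Order.TTheory GRing.Theory Num.Theory.

Local Open Scope classical_set_scope.
Local Open Scope ring_scope.

Record graph (V : Type) := Graph {
  adj : V -> V -> Prop;
  adj_sym : forall u v, adj u v -> adj v u;
  adj_irrefl : forall v, ~ adj v v
}.

Section Graphs.
Variables (V : Type) (G : graph V).

(* The induced subgraph G[W] is kept on the ambient vertex type V: its edges
   are the edges of G with both ends in W, so that vertices outside W become
   isolated. *)
Definition induced_adj (W : set V) (u v : V) : Prop :=
  [/\ W u, W v & adj G u v].

Lemma induced_adj_sym (W : set V) u v :
  induced_adj W u v -> induced_adj W v u.
Proof. by case=> Wu Wv uv; split=> //; exact: adj_sym. Qed.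

Lemma induced_adj_irrefl (W : set V) v : ~ induced_adj W v v.
Proof. by case=> _ _; exact: adj_irrefl. Qed.

Definition induced (W : set V) : graph V :=
  Graph (@induced_adj_sym W) (@induced_adj_irrefl W).

Definition neighbors (v : V) : set V := [set u | adj G v u].

Definition infinite_degree (v : V) : Prop := infinite_set (neighbors v).

Definition labeling (phi : V -> int) : Prop := bijective phi.

Definition increasing_two_sided_path (phi : V -> int) (p : int -> V) : Prop :=
  [/\ injective p,
      forall i : int, adj G (p i) (p (i + 1)) &
      forall i : int, phi (p i) < phi (p (i + 1))].

End Graphs.

(* Main.v *)
Require Import Defs.
From mathcomp Require Import all_boot all_order all_algebra zify.
From mathcomp Require Import boolp classical_sets functions cardinality.

(* (1) => (2): split the vertices by the sign of their label; from the edge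
   [w1 w2] one walks greedily upwards in [W2] and downwards in [W1].

   (2) => (1): it suffices to label each [Vi] by the natural numbers so that
   every vertex starting an increasing ray lies in a set [Wi] of infinite
   minimum degree; putting [V1] on the negative integers in reversed order, an
   increasing two-sided path then crosses from [W1] to [W2].  Delete,
   transfinitely and one at a time, vertices with finitely many remaining
   neighbours; [Wi] is what survives, and every deleted [v] has only finitely
   many neighbours outlasting it.  Enumerate the vertices in finite layers,
   each layer listed with the last deleted first, so that a ray can move to a
   vertex outlasting its current one only by changing layer.  Layers are closed
   so that the vertices outlasting some member of an earlier layer that are
   reached by such a move serve as cuts: no later layer is left by an edge
   passing from below to above a cut, nor by one entering [Wi].  Hence after a
   rise to [y] a ray never outlasts [y] again; the targets of its rises
   decrease in the well-founded deletion order, so the ray eventually only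
   moves to vertices deleted earlier, which cannot go on forever. *)

Local Open Scope classical_set_scope.

(** * Transfinite deletion of vertices with finitely many remaining neighbours *)

Section Removal.
Variables (T : Type) (E : T -> T -> Prop).

Definition removable (R : set T) (v : T) : Prop :=
  ~ R v /\ finite_set [set u | E v u /\ ~ R u].

Variable pick : set T -> T.

(** If [pick R] is not removable, nothing is added and the process halts at [R]. *)
Definition next (R : set T) : set T :=
  R `|` [set v | v = pick R /\ removable R v].

(** Stages of the transfinite iteration of [next], without ordinals; the union of the empty family
    is the initial stage. *)
Inductive tower : set T -> Prop :=
| tower_next R : tower R -> tower (next R)
| tower_bigcup (C : set (set T)) :
    C `<=` tower -> tower (\bigcup_(R in C) R).

Lemma sub_next R : R `<=` next R. Proof. exact: subsetUl. Qed.

(* Zermelo's double induction: tower sets form a chain although [next] is not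
   monotone. *)
Lemma tower_chain R S : tower R -> tower S -> next R `<=` S \/ S `<=` R.
Proof.
have left_of_right X : tower X ->
    (forall Y, tower Y -> next Y `<=` X \/ X `<=` Y) ->
    forall Y, tower Y -> next X `<=` Y \/ Y `<=` X.
  move=> tX right Y; elim=> {Y} [Y tY [XY|YX]|C tC IH].
  - by left; apply: subset_trans XY _; exact: sub_next.
  - case: (right Y tY) => [|XY]; first by right.
    by left; have -> : X = Y by apply/seteqP.
  - have [[Y CY XY]|none] := pselect (exists2 Y, C Y & next X `<=` Y).
      by left=> x /XY Yx; exists Y.
    right=> x [Y CY Yx]; case: (IH Y CY) => [XY|]; last exact.
    by case: none; exists Y.
have right X : tower X -> forall Y, tower Y -> next Y `<=` X \/ X `<=` Y.
  elim=> {X} [X tX IH|C tC IH] Y tY.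
    have [YX|XY] := IH Y tY.
      by left; apply: subset_trans YX _; exact: sub_next.
    have [|YX] := left_of_right X tX IH Y tY; first by right.
    by left; have -> : X = Y by apply/seteqP.
  have [[X CX YX]|none] := pselect (exists2 X, C X & next Y `<=` X).
    by left=> x /YX Xx; exists X.
  right=> x [X CX Xx]; case: (IH X CX Y tY) => [YX|]; last exact.
  by case: none; exists X.
by move=> tR tS; exact: right.
Qed.

Lemma tower_fixpoint P R : tower P -> next P `<=` P -> tower R -> R `<=` P.
Proof.
move=> tP fixP; elim=> {R} [R tR RP|C _ IH]; last by move=> x [R CR]; exact: IH.
have [//|PR] := tower_chain R P tR tP.
by have -> : R = P by apply/seteqP.
Qed.

Lemma tower_total R S : tower R -> tower S -> R `<=` S \/ S `<=` R.
Proof.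
move=> tR tS; case: (tower_chain R S tR tS) => [RS|]; last by right.
by left; apply: subset_trans RS; exact: sub_next.
Qed.

(** The last stage before a member of [S] is deleted. *)
Definition avoiding (S : set T) : set T :=
  \bigcup_(R in [set R | tower R /\ R `&` S = set0]) R.

Lemma tower_avoiding S : tower (avoiding S).
Proof. by apply: tower_bigcup => R []. Qed.

Lemma avoidingP S x : avoiding S x -> ~ S x.
Proof.
by move=> [R [_ RS0] Rx] Sx; have : (R `&` S) x by []; rewrite RS0.
Qed.

(** The first deleted member of [S]. If the stage after [avoiding S] still missed [S], then
    [avoiding S] would be a fixed point of [next], hence contain every stage and with it [x]. *)
Lemma avoiding_pick S x :
  S x -> (exists2 R, tower R & R x) ->
  S (pick (avoiding S)) /\ removable (avoiding S) (pick (avoiding S)).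
Proof.
move=> Sx [R tR Rx]; set P := avoiding S.
have [[y [[Py|[-> rem]] Sy]]|none] := pselect (exists y, next P y /\ S y).
- by have := avoidingP _ _ Py.
- by [].
have: next P `<=` P.
  move=> y Py; exists (next P) => //; split.
    by apply: tower_next; exact: tower_avoiding.
  by apply/seteqP; split=> // z [Pz Sz]; case: none; exists z.
move=> /(tower_fixpoint _ _ (tower_avoiding S))/(_ tR)/(_ _ Rx).
by move/avoidingP.
Qed.

Definition removed_before (u v : T) : Prop :=
  exists R, [/\ tower R, R u & ~ R v].

Definition never_removed : set T := [set v | forall R, tower R -> ~ R v].

Lemma removedE v : ~ never_removed v -> exists2 R, tower R & R v.
Proof.
by move=> nv; apply: contrapT => no; apply: nv => R tR Rv; apply: no; exists R.
Qed.

Lemma pick_avoiding1 v : ~ never_removed v ->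
  v = pick (avoiding [set v]) /\ removable (avoiding [set v]) v.
Proof.
move=> /removedE rv.
by have [/= pv] := avoiding_pick [set v] v erefl rv; rewrite pv.
Qed.

End Removal.

(* [before u v] says that [u] is deleted before [v] in a transfinite process
   deleting one vertex at a time, always one with finitely many neighbours
   left; [W] is the set of vertices that survive. *)
Record removal_order {T : Type} (E : T -> T -> Prop) (W : set T)
    (before : T -> T -> Prop) : Prop := RemovalOrder {
  core_degree : forall w, W w -> infinite_set [set u | E w u /\ W u];
  before_irrefl : forall v, ~ before v v;
  before_trans : forall u v w, before u v -> before v w -> before u w;
  before_cotrans : forall u v w, before u w -> before u v \/ before v w;
  before_core : forall u w, ~ W u -> W w -> before u w;
  core_before : forall v w, W w -> ~ before w v;
  before_total : forall u v, ~ W u -> ~ W v -> u <> v ->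
    before u v \/ before v u;
  before_finite : forall v, ~ W v -> finite_set [set u | E v u /\ ~ before u v];
  before_min : forall S : set T, S !=set0 ->
    exists2 m, S m & forall x, S x -> ~ before x m
}.

Lemma removal_order_exists {T : Type} (E : T -> T -> Prop) (x0 : T) :
  exists W before, removal_order E W before.
Proof.
have /choice[pick pickP] : forall R : set T, exists y,
    (exists v, removable T E R v) -> removable T E R y.
  move=> R; have [[v rv]|no] := pselect (exists v, removable T E R v).
    by exists v.
  by exists x0 => /no.
exists (never_removed T E pick), (removed_before T E pick); split.
(* The union [U] of all stages is itself a stage; a survivor with finitely many surviving neighbours
   would let [next] enlarge it. *)
- move=> w Ww fin; pose U := \bigcup_(R in tower T E pick) R.
  have tU : tower T E pick U by exact: tower_bigcup.
  have remw : removable T E U w.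
    split=> [[R tR Rw]|]; first exact: (Ww R tR Rw).
    apply: sub_finite_set fin => u [Ewu nUu]; split=> // R tR Ru.
    by apply: nUu; exists R.
  have [nU _] := pickP U (ex_intro _ w remw).
  apply: nU; exists (next T E pick U); first exact: tower_next.
  by right; split=> //; apply: pickP; exists w.
- by move=> v [R []].
- move=> u v w [R [tR Ru nRv]] [S [tS Sv nSw]]; exists S; split=> //.
  by have [RS|SR] := tower_total T E pick R S tR tS; [exact: RS|case: nRv; exact: SR].
- move=> u v w [R [tR Ru nRw]]; have [Rv|nRv] := pselect (R v).
    by right; exists R.
  by left; exists R.
- by move=> u w /(removedE T E pick)[R tR Ru] Ww; exists R; split=> //; exact: Ww.
- by move=> v w Ww [R [tR Rw _]]; exact: (Ww R tR Rw).
- move=> u v /(pick_avoiding1 T E pick)[]; set P := avoiding _ _ _ _ => uP remu nv uv.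
  have tP : tower T E pick P by exact: tower_avoiding.
  have [Pv|nPv] := pselect (P v); first by right; exists P; split=> //; case: remu.
  left; exists (next T E pick P); split; first exact: tower_next.
    by right; rewrite -uP.
  by move=> [//|[]]; rewrite -uP => vu; case: uv.
- move=> v /(pick_avoiding1 T E pick)[_ [nPv]]; set P := avoiding _ _ _ _ => /=.
  apply: sub_finite_set => u [Evu nuv]; split=> // Pu; apply: nuv.
  by exists P; split=> //; exact: tower_avoiding.
- move=> S [s Ss].
  (* Only deleted vertices precede anything: if [S] has none, each member is minimal; otherwise the
     first one deleted is. *)
  have [rem|never] := pselect (exists s, S s /\ ~ never_removed T E pick s);
    last first.
    exists s => // x Sx [R [tR Rx _]].
    by apply: never; exists x; split=> // /(_ R tR); exact.
  case: rem => {Ss}s [Ss /(removedE T E pick) rs].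
  have [Sc remc] := avoiding_pick T E pick S s Ss rs.
  set P := avoiding _ _ _ _ in Sc remc; exists (pick P) => // x Sx [R [tR Rx nRc]].
  have tP : tower T E pick P by exact: tower_avoiding.
  case: (tower_chain T E pick P R tP tR) => [PR|RP].
    by apply: nRc; apply: PR; right.
  by have := avoidingP T E pick S x (RP x Rx).
Qed.

(** * Finiteness of reachable sets *)

Inductive reachable {T : Type} (R : T -> T -> Prop) (v : T) : T -> Prop :=
| reachable_refl : reachable R v v
| reachable_step u w : R v u -> reachable R u w -> reachable R v w.

Lemma reachable_trans {T : Type} (R : T -> T -> Prop) v u w :
  reachable R v u -> R u w -> reachable R v w.
Proof.
elim=> {v u} [u|v x u vx _ IH] uw.
  exact: reachable_step uw (reachable_refl _ _).
exact: reachable_step vx (IH uw).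
Qed.

(** Branching is finite and [K - mu v] drops at each step, which bounds the length of walks. *)
Lemma finite_reachable {T : Type} (R : T -> T -> Prop) (mu : T -> nat) (K : nat) :
  (forall v, finite_set [set u | R v u]) ->
  (forall v u, R v u -> mu v < mu u <= K) ->
  forall v, finite_set (reachable R v).
Proof.
move=> finR muR v; have [k] := ubnP (K - mu v).
elim: k => // k IH in v *; rewrite ltnS => le_k.
apply: (@sub_finite_set _ _ ([set v] `|` \bigcup_(u in R v) reachable R u)).
  by move=> w [|u {}w vu uw]; [left | right; exists u].
rewrite finite_setU; split=> //; apply: bigcup_finite => [|u vu]; first exact: finR.
by apply: IH; have /andP[] := muR v u vu; lia.
Qed.

(** * Finite layers closed under crossing edges *)

Section Layers.
Variables (E : nat -> nat -> Prop) (W : set nat) (before : nat -> nat -> Prop).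
Hypothesis ord : removal_order E W before.

Definition later (v u : nat) : Prop := [/\ ~ W v, E v u & ~ before u v].

Definition crossing (C : set nat) (v u : nat) : Prop :=
  [/\ ~ W v, E v u & W u \/ exists y, [/\ C y, ~ before y v & before y u]].

Lemma finite_later v : finite_set (later v).
Proof.
have [Wv|nWv] := pselect (W v).
  by apply: (@sub_finite_set _ _ set0) => // u [].
by apply: sub_finite_set (before_finite _ _ _ ord v nWv) => u [].
Qed.

Lemma crossing_later C v u : crossing C v u -> later v u.
Proof.
case=> nWv Evu cross; split=> // buv; case: cross => [Wu|[y [_ nyv yu]]].
  exact: (core_before _ _ _ ord v u).
by apply: nyv; exact: (before_trans _ _ _ ord y u v).
Qed.

(* The number of cuts below a vertex, plus one for vertices of [W], increases
   along crossing edges. *)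
Lemma crossing_closure (C A : set nat) : finite_set C -> finite_set A ->
  exists B, [/\ finite_set B, A `<=` B &
    forall v u, B v -> crossing C v u -> B u].
Proof.
move=> /finite_seqP[c cE] finA.
pose cuts v := [pred y | `[< before y v >]].
have cutsW v u : crossing C v u ->
    `[< W v >] + count (cuts v) c < `[< W u >] + count (cuts u) c.
  move=> vu; have [nWv _ nuv] := crossing_later _ _ _ vu.
  have sub : subpred (cuts v) (cuts u).
    move=> y /asboolP yv; apply/asboolP.
    by case: (before_cotrans _ _ _ ord y u v yv) => // /nuv.
  rewrite (asboolF nWv) add0n.
  case: vu => _ _ [Wu|[y [Cy nyv yu]]].
    by rewrite (asboolT Wu) add1n ltnS; exact: sub_count.
  have yc : y \in c by move: Cy; rewrite cE.
  apply: leq_trans (leq_addl _ _).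
  have /permP pe := perm_to_rem yc; rewrite !pe /= (asboolF nyv) (asboolT yu).
  by rewrite add0n add1n ltnS; exact: sub_count.
have finR v : finite_set [set u | crossing C v u].
  by apply: sub_finite_set (finite_later v) => u /crossing_later.
exists (\bigcup_(v in A) reachable (crossing C) v); split.
- apply: bigcup_finite => // v _.
  (* At most [size c] cuts count for a vertex, and membership in [W] adds one. *)
  apply: (finite_reachable _ (fun v => `[< W v >] + count (cuts v) c) (size c).+1).
    exact: finR.
  move=> {}v u /cutsW -> /=; rewrite -add1n leq_add ?count_size //.
  by case: asboolP.
- by move=> v Av; exists v => //; exact: reachable_refl.
- by move=> v u [x Ax xv] vu; exists x => //; exact: reachable_trans xv vu.
Qed.

Definition cut_by (s : seq nat) : set nat :=
  [set y | y \in s \/ exists2 x, x \in s & later x y].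

(** [t] is the new layer. Requiring [n] makes the layers exhaust all vertices; requiring the cuts to
    be listed keeps them cuts for all later layers. *)
Definition extends (n : nat) (s r : seq nat) : Prop :=
  exists t, [/\ r = s ++ t, uniq s -> uniq r,
    forall y, y = n \/ cut_by s y -> y \in r,
    forall v u, v \in r -> crossing (cut_by s) v u -> u \in r &
    forall u v, u \in t -> v \in t -> index u t < index v t -> ~ before u v].

Lemma extends_exists n s : exists r, extends n s r.
Proof.
have fin_s : finite_set [set` s] by apply/finite_seqP; exists s.
have finC : finite_set (cut_by s).
  apply: (@sub_finite_set _ _ ([set` s] `|` \bigcup_(x in [set` s]) later x)).
    by move=> y [ys|[x xs xy]]; [left | right; exists x].
  rewrite finite_setU; split=> //; apply: bigcup_finite => // x _.
  exact: finite_later.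
have finA : finite_set ([set n] `|` cut_by s) by rewrite finite_setU.
have [B [/finite_seqP[b ->] AB closed]] := crossing_closure _ _ finC finA.
(* A total preorder in which the vertices of [W] are tied; sorting by it puts the last deleted
   first. *)
pose leT := [rel u v | `[< ~ before u v >]].
have leT_total : total leT.
  move=> u v; apply/orP; have [uv|nuv] := pselect (before u v); last first.
    by left; apply/asboolP.
  right; apply/asboolP => vu.
  exact: (before_irrefl _ _ _ ord u) (before_trans _ _ _ ord _ _ _ uv vu).
have leT_trans : transitive leT.
  move=> v u w /asboolP uv /asboolP vw; apply/asboolP => uw.
  by case: (before_cotrans _ _ _ ord u v w uw).
pose t := sort leT [seq v <- undup b | v \notin s].
have mem_r v : (v \in s ++ t) = (v \in s) || (v \in b).
  rewrite mem_cat mem_sort mem_filter mem_undup.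
  by case: (v \in s).
have mem_b v : v \in s -> v \in b by move=> vs; apply: (AB v); right; left.
exists (s ++ t), t; split=> //.
- move=> us; rewrite cat_uniq us sort_uniq filter_uniq ?undup_uniq // andbT.
  by apply/hasPn => v; rewrite mem_sort mem_filter => /andP[].
- by move=> y Cy; rewrite mem_r; apply/orP; right; exact: (AB y).
- move=> v u; rewrite !mem_r => vr vu; apply/orP; right; apply: (closed v) => //.
  by case/orP: vr => // /mem_b.
- move=> u v ut vt iuv; have : pairwise leT t.
    by rewrite -(sorted_pairwise leT_trans) sort_sorted.
  move=> /(pairwiseP 0)/(_ (index u t) (index v t)).
  by rewrite !nth_index // !unfold_in /= !index_mem => /(_ ut vt iuv)/asboolP.
Qed.

(** * The enumeration obtained by concatenating the layers *)

Variable s : nat -> seq nat.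
Hypotheses (s0 : s 0 = [::]) (sS : forall n, extends n (s n) (s n.+1)).

Lemma layers_prefix n m : n <= m -> exists t, s m = s n ++ t.
Proof.
move=> /subnKC <-; elim: (m - n) => [|k [t st]].
  by exists [::]; rewrite addn0 cats0.
have [u [su _ _ _ _]] := sS (n + k).
by exists (t ++ u); rewrite addnS su st catA.
Qed.

Lemma layers_sub n m : n <= m -> {subset s n <= s m}.
Proof. by move=> /layers_prefix[t ->] v; rewrite mem_cat => ->. Qed.

Lemma layers_uniq n : uniq (s n).
Proof. by elim: n => [|n IH]; [rewrite s0 | have [t []] := sS n; auto]. Qed.

Lemma layers_mem v : v \in s v.+1.
Proof. by have [t [_ _ memS _ _]] := sS v; apply: memS; left. Qed.

Lemma layers_size n : n <= size (s n).
Proof.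
rewrite -[X in X <= _](size_iota 0); apply: uniq_leq_size; first exact: iota_uniq.
move=> v; rewrite mem_iota add0n => /andP[_ vn].
exact: layers_sub vn _ (layers_mem v).
Qed.

Lemma layers_entry v : exists n, v \in s n.+1 /\ v \notin s n.
Proof.
have exn : exists n, v \in s n by exists v.+1; exact: layers_mem.
case: (ex_minnP exn) => -[|n]; first by rewrite s0.
move=> vn nmin; exists n; split=> //; apply/negP => /nmin; lia.
Qed.

Definition position (v : nat) : nat := index v (s v.+1).

Lemma positionE n v : v \in s n -> position v = index v (s n).
Proof.
move=> vn; have vv := layers_mem v; rewrite /position.
have [t st] := layers_prefix _ _ (leq_maxl n v.+1).
have [u su] := layers_prefix _ _ (leq_maxr n v.+1).
have := su; rewrite st => /(congr1 (index v)).
by rewrite !index_cat vn vv => ->.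
Qed.

Lemma position_mem n u v : position v <= position u -> u \in s n -> v \in s n.
Proof.
move=> vu un; apply: contraLR vu => nvn; rewrite -ltnNge.
have [t st] := layers_prefix _ _ (leq_maxl n v.+1).
have [um vm] : u \in s (maxn n v.+1) /\ v \in s (maxn n v.+1).
  split; first exact: layers_sub (leq_maxl _ _) _ un.
  exact: layers_sub (leq_maxr _ _) _ (layers_mem v).
rewrite (positionE _ _ um) (positionE _ _ vm) st !index_cat un (negbTE nvn).
by rewrite ltn_addr // index_mem.
Qed.

Lemma position_block n u v : u \in s n.+1 -> v \in s n.+1 ->
  u \notin s n -> v \notin s n -> position u < position v -> ~ before u v.
Proof.
move=> un vn nun nvn; rewrite (positionE _ _ un) (positionE _ _ vn).
have [t [st _ _ _ sorted_t]] := sS n.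
move: un vn; rewrite st !mem_cat (negbTE nun) (negbTE nvn) /= => ut vt.
rewrite !index_cat (negbTE nun) (negbTE nvn) ltn_add2l.
exact: sorted_t.
Qed.

Lemma position_bij : bijective position.
Proof.
(* [s i.+1] has more than [i] entries, so the default [0] is never reached. *)
pose g i := nth 0 (s i.+1) i.
have ltsz i : i < size (s i.+1) by exact: layers_size.
have gK : cancel g position.
  move=> i; rewrite (positionE i.+1) ?mem_nth //.
  by rewrite index_uniq ?layers_uniq.
exists g => //; apply: inj_can_sym gK _ => u v.
have um := layers_sub _ _ (leq_maxl u.+1 v.+1) _ (layers_mem u).
have vm := layers_sub _ _ (leq_maxr u.+1 v.+1) _ (layers_mem v).
rewrite (positionE _ _ um) (positionE _ _ vm) => /(congr1 (nth 0 (s (maxn u.+1 v.+1)))).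
by rewrite !nth_index.
Qed.

(** * No increasing ray starts outside [W] *)

Section Ray.
Variable q : nat -> nat.
Hypothesis q_edge : forall i, E (q i) (q i.+1).
Hypothesis q_incr : forall i, position (q i) < position (q i.+1).
Hypothesis q0 : ~ W (q 0).

Lemma ray_mono i j : i < j -> position (q i) < position (q j).
Proof.
elim: j => // j IH; rewrite ltnS leq_eqVlt => /predU1P[-> //|/IH ij].
exact: ltn_trans ij (q_incr j).
Qed.

Lemma ray_mono_mem i j n : i <= j -> q i \notin s n -> q j \notin s n.
Proof.
rewrite leq_eqVlt => /predU1P[<- //|/ray_mono/ltnW ij].
by apply: contra; exact: position_mem.
Qed.

(* Within a layer a ray can only move to vertices deleted earlier, so a step
   along a crossing edge, which stays within the layer, is impossible. *)
Lemma ray_no_crossing i m :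
  q i \in s m.+1 -> q i \notin s m -> ~ crossing (cut_by (s m)) (q i) (q i.+1).
Proof.
move=> qm nqm cross; have [t [_ _ _ closed _]] := sS m.
have qm' := closed _ _ qm cross.
have nqm' := ray_mono_mem i i.+1 m (leqnSn i) nqm.
have := position_block _ _ _ qm qm' nqm nqm' (q_incr i).
case: cross => nWq _ [Wq|[y [_ nyq yq]]]; apply.
  exact: (before_core _ _ _ ord).
by case: (before_cotrans _ _ _ ord _ (q i) _ yq).
Qed.

Lemma ray_outside i : ~ W (q i).
Proof.
elim: i => // i nWq Wq.
have [m [qm nqm]] := layers_entry (q i).
by apply: (ray_no_crossing i m qm nqm); split=> //; left.
Qed.

(* Once a ray has risen to [y], every layer it meets afterwards is cut by [y],
   so it never gets past [y] again. *)
Lemma ray_after_rise i j :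
  ~ before (q i.+1) (q i) -> i < j -> ~ before (q i.+1) (q j).
Proof.
move=> rise; have [n [qn nqn]] := layers_entry (q i).
have rise_later : later (q i) (q i.+1) by split=> //; exact: ray_outside.
(* A rise leaves its layer, since each layer lists the last deleted first. *)
have nqn1 : q i.+1 \notin s n.+1.
  apply/negP => qn1; apply: (position_block _ _ _ qn qn1 nqn _ (q_incr i)).
    exact: ray_mono_mem (leqnSn i) nqn.
  have neq : q i <> q i.+1 by move=> eq_q; have := q_incr i; rewrite eq_q ltnn.
  by case: (before_total _ _ _ ord (q i) (q i.+1)) => //; exact: ray_outside.
elim: j => // j IH; rewrite ltnS leq_eqVlt => /predU1P[<-|ij].
  exact: (before_irrefl _ _ _ ord).
move=> bj; have [m [qm nqm]] := layers_entry (q j).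
have nm : n < m.
  rewrite ltnNge; apply/negP => mn.
  have : q j \in s n.+1 by apply: layers_sub qm.
  by apply/negP; exact: ray_mono_mem ij nqn1.
apply: (ray_no_crossing j m qm nqm); split=> //; first exact: ray_outside.
right; exists (q i.+1); split=> //; last exact: IH.
have cut_n : cut_by (s n.+1) (q i.+1) by right; exists (q i).
(* For [m = n.+1] the target is a cut as a [later] neighbour of [q i]; beyond that, because it has
   been listed. *)
move: nm; rewrite leq_eqVlt => /predU1P[<- //|nm]; left.
have [t [_ _ memS _ _]] := sS n.+1.
by apply: layers_sub nm _ (memS _ (or_intror cut_n)).
Qed.

Lemma ray_contradiction : False.
Proof.
have q_neq i j : i < j -> q i <> q j.
  by move=> /ray_mono + eq_q; rewrite eq_q ltnn.
pose rises := [set i | ~ before (q i.+1) (q i)].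
(* A tail without rises would have no vertex deleted first. *)
have finally_falls k : ~ (forall i, k <= i -> ~ rises i).
  move=> falls.
  have [_ [i /= ki <-] imin] := before_min _ _ _ ord (q @` [set i | k <= i])
    (ex_intro _ (q k) (ex_intro2 _ _ k (leqnn k) erefl)).
  apply: (falls i ki) => /imin; apply; exists i.+1 => //=.
  exact: leqW.
have [r0 rise0] : rises !=set0.
  by apply: contrapT => no; apply: (finally_falls 0) => i _ ri; apply: no; exists i.
(* After a rise with minimal target no rise can follow: its target would be deleted neither before
   nor after that one. *)
have [_ [i ri <-] imin] := before_min _ _ _ ord [set q i.+1 | i in rises]
  (ex_intro _ (q r0.+1) (ex_intro2 _ _ r0 rise0 erefl)).
apply: (finally_falls i.+1) => j ij rj.
case: (before_total _ _ _ ord (q i.+1) (q j.+1)).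
- exact: ray_outside.
- exact: ray_outside.
- by apply: q_neq; rewrite ltnS.
- exact: ray_after_rise ri (leqW ij).
- by apply: imin; exists j.
Qed.

End Ray.
End Layers.

(** * Rays and labelings by natural numbers on one side of a partition *)

Lemma labeling_rays_start_in_core (E : nat -> nat -> Prop) :
  exists (W : set nat) (f : nat -> nat),
    [/\ forall w, W w -> infinite_set [set u | E w u /\ W u],
        bijective f &
        forall q : nat -> nat, (forall i, E (q i) (q i.+1)) ->
          (forall i, f (q i) < f (q i.+1)) -> W (q 0)].
Proof.
have [W [before ord]] := removal_order_exists E 0.
have ext p : exists r, extends E W before p.1 p.2 r by exact: extends_exists.
have [step stepP] := choice ext.
pose s := fix s n := if n is m.+1 then step (m, s m) else [::].
have sS n : extends E W before n (s n) (s n.+1) by exact: (stepP (n, s n)).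
exists W, (position s); split.
- exact: core_degree ord.
- exact: position_bij sS.
- move=> q q_edge q_incr; apply: contrapT => q0.
  exact: (ray_contradiction E W before ord s erefl sS q q_edge q_incr q0).
Qed.

Import Order.TTheory GRing.Theory Num.Theory.

Lemma infinite_set_surj {T : Type} (A : set T) (f : T -> nat) :
  (forall n, exists2 v, A v & f v = n) -> infinite_set A.
Proof.
move=> surj finA; apply: infinite_nat.
by apply: sub_finite_set (finite_image f finA) => n _; have [v] := surj n; exists v.
Qed.

(** Transports the labeling of [nat] along a bijection [h] from [X]; [f] is meaningful only on
    [X]. *)
Lemma ray_labeling {V : Type} (G : graph V) (X : set V) :
  (X #= [set: nat])%card ->
  exists (W : set V) (f : V -> nat),
    [/\ W `<=` X,
        forall w, W w -> infinite_degree (induced G W) w,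
        {in X &, injective f},
        forall n, exists2 v, X v & f v = n &
        forall q : nat -> V, (forall i, X (q i)) ->
          (forall i, adj G (q i) (q i.+1)) ->
          (forall i, f (q i) < f (q i.+1)) -> W (q 0)].
Proof.
move=> /card_set_bijP[h [_ hinj hsurj]].
have exe n : exists v, X v /\ h v = n by have [v Xv hv] := hsurj n I; exists v.
have [e eP] := choice exe.
have hK v : X v -> e (h v) = v.
  by move=> Xv; have [Xe he] := eP (h v); apply: hinj; rewrite ?inE.
have [W [f [degW [g fK gK] rayW]]] :=
  labeling_rays_start_in_core (fun m n => adj G (e m) (e n)).
exists [set v | X v /\ W (h v)], (f \o h); split.
- by move=> v [].
- move=> w [Xw Ww] fin; apply: (degW _ Ww).
  apply: sub_finite_set (finite_image h fin) => n [wn Wn]; have [Xn hn] := eP n.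
  exists (e n) => //; split=> //; first by rewrite /= hn.
  by rewrite -{1}(hK _ Xw).
- by move=> u v uX vX /= /(can_inj fK); exact: hinj.
- move=> n; have [Xn hn] := eP (g n); exists (e (g n)) => //=.
  by rewrite hn gK.
- move=> q Xq q_edge q_incr; split=> //; apply: (rayW (h \o q)) => //= i.
  by rewrite !hK.
Qed.

(** Injectivity leaves only finitely many vertices of [W] with value at most [f v], so some
    neighbour of [v] in [W] has a larger one. *)
Lemma greedy_ray {V : Type} (G : graph V) (W : set V) (f : V -> nat) (w : V) :
  {in W &, injective f} ->
  (forall v, W v -> infinite_degree (induced G W) v) -> W w ->
  exists q : nat -> V,
    [/\ q 0 = w, forall i, W (q i), forall i, adj G (q i) (q i.+1) &
        forall i, f (q i) < f (q i.+1)].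
Proof.
move=> finj degW Ww.
have grow v : exists u, W v -> [/\ W u, adj G v u & f v < f u].
  have [[u uP]|no] := pselect (exists u, [/\ W u, adj G v u & f v < f u]).
    by exists u.
  exists v => Wv; case: (degW v Wv).
  have inj : {in neighbors (induced G W) v &, injective f}.
    move=> x y; rewrite !inE => -[_ Wx _] [_ Wy _].
    by apply: finj; rewrite inE.
  rewrite -(eq_finite_set (inj_card_eq inj)).
  apply: sub_finite_set (finite_II (f v).+1) => _ [u [_ Wu vu] <-] /=.
  by rewrite ltnS leqNgt; apply/negP => lt_vu; apply: no; exists u.
have [next_v nextP] := choice grow.
have Wq i : W (iter i next_v w) by elim: i => //= i /nextP[].
by exists (fun i => iter i next_v w); split=> // i; have [] := nextP _ (Wq i).
Qed.

(** * Strictly increasing integer sequences *)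

Local Open Scope ring_scope.

Lemma int_growth (psi : int -> int) (i : int) (n : nat) :
  (forall i, psi i < psi (i + 1)) -> psi i + n%:Z <= psi (i + n%:Z).
Proof.
move=> incr; elim: n => [|n IH]; first by rewrite !addr0.
have := incr (i + n%:Z); have -> : i + n%:Z + 1 = i + n.+1%:Z by lia.
lia.
Qed.

Lemma int_mono (psi : int -> int) (i j : int) :
  (forall i, psi i < psi (i + 1)) -> i < j -> psi i < psi j.
Proof.
move=> incr ij; have := int_growth psi i `|j - i|%N incr.
have -> : i + `|j - i|%N%:Z = j by lia.
lia.
Qed.

Lemma int_crossing (psi : int -> int) :
  (forall i, psi i < psi (i + 1)) -> exists k, psi k < 0 /\ 0 <= psi (k + 1).
Proof.
(* Each step gains at least one, so going back [N > a] steps from [0] makes [psi] negative. *)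
move=> incr; pose a := psi 0; pose N := `|a|%N.+1; pose b : int := - N%:Z.
have psib : psi b < 0.
  have := int_growth psi b N incr.
  have -> : psi (b + N%:Z) = a by congr psi; rewrite /b; lia.
  by rewrite /N; lia.
have exn : exists n : nat, 0 <= psi (b + n%:Z).
  exists `|psi b|%N; have := int_growth psi b `|psi b|%N incr; lia.
case: (ex_minnP exn) => -[|n] psin nmin; first by move: psin; rewrite addr0; lia.
exists (b + n%:Z); split; last by have -> : b + n%:Z + 1 = b + n.+1%:Z by lia.
by rewrite ltNge; apply/negP => /nmin; rewrite ltnn.
Qed.

Local Close Scope ring_scope.

(** * Gluing two rays into a two-sided path, and splitting such a path into two *)

Theorem theorem4p2 (V : Type) (G : graph V)
    (countV : ([set: V] #= [set: nat])%card) :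
  (forall V1 V2 : set V,
      V1 `|` V2 = [set: V] -> V1 `&` V2 = set0 ->
      infinite_set V1 -> infinite_set V2 ->
      exists W1 W2 : set V,
        [/\ W1 `<=` V1,
            W2 `<=` V2,
            forall v, W1 v -> infinite_degree (induced G W1) v,
            forall v, W2 v -> infinite_degree (induced G W2) v &
            exists w1 w2, [/\ W1 w1, W2 w2 & adj G w1 w2]])
  <->
  (forall phi : V -> int, labeling phi ->
      exists p : int -> V, increasing_two_sided_path G phi p).
Proof.
split=> [part phi [g phiK gK]|paths V1 V2 V12 V12_0 inf1 inf2].
  pose abs v := `|phi v|%N.
  have phi_inj := can_inj phiK.
  pose V1 := [set v | (phi v < 0)%R]; pose V2 := [set v | (0 <= phi v)%R].
  have V12 : V1 `|` V2 = [set: V].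
    by apply/seteqP; split=> // v _; rewrite /V1 /V2 /=; lia.
  have V12_0 : V1 `&` V2 = set0.
    by apply/seteqP; split=> // v []; rewrite /V1 /V2 /=; lia.
  have inf1 : infinite_set V1.
    apply: (infinite_set_surj _ (fun v => (abs v).-1)) => n.
    by exists (g (Negz n)); rewrite /V1 /abs /= gK.
  have inf2 : infinite_set V2.
    apply: (infinite_set_surj _ abs) => n.
    by exists (g (Posz n)); rewrite /V2 /abs /= gK.
  have [W1 [W2 [sub1 sub2 deg1 deg2 [w1 [w2 [Ww1 Ww2 w12]]]]]] :=
    part V1 V2 V12 V12_0 inf1 inf2.
  have neg v : W1 v -> (phi v < 0)%R := @sub1 v.
  have pos v : W2 v -> (0 <= phi v)%R := @sub2 v.
  have abs_inj1 : {in W1 &, injective abs}.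
    move=> u v; rewrite !inE /abs => /neg u0 /neg v0 uv.
    by apply: phi_inj; lia.
  have abs_inj2 : {in W2 &, injective abs}.
    move=> u v; rewrite !inE /abs => /pos u0 /pos v0 uv.
    by apply: phi_inj; lia.
  have [q1 [q10 W1q adj1 incr1]] := greedy_ray G W1 abs w1 abs_inj1 deg1 Ww1.
  have [q2 [q20 W2q adj2 incr2]] := greedy_ray G W2 abs w2 abs_inj2 deg2 Ww2.
  (* [Negz n] is [-(n+1)]: the ray [q1] is traversed backwards up to index [-1], and the edge
     [w1 w2] joins [-1] to [0]. *)
  pose p (i : int) := match i with Posz n => q2 n | Negz n => q1 n end.
  have NegzS n : (Negz n.+1 + 1 = Negz n)%R by lia.
  have PoszS n : (Posz n + 1 = Posz n.+1)%R by lia.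
  have p_incr i : (phi (p i) < phi (p (i + 1)))%R.
    case: i => [n|[|n]].
    - rewrite PoszS /=; move: (incr2 n) (pos _ (W2q n)) (pos _ (W2q n.+1)).
      rewrite /abs /=; lia.
    - have -> : (Negz 0 + 1 = Posz 0)%R by [].
      move: (neg _ (W1q 0)) (pos _ (W2q 0)) => /=; lia.
    - rewrite NegzS /=; move: (incr1 n) (neg _ (W1q n)) (neg _ (W1q n.+1)).
      rewrite /abs /=; lia.
  have mono i j : (i < j)%R -> (phi (p i) < phi (p j))%R.
    exact: (int_mono (phi \o p)).
  exists p; split=> // [i j pij|].
    by case: (ltgtP i j) => // /mono; rewrite pij ltxx.
  case=> [n|[|n]]; first by rewrite PoszS; exact: adj2.
    by have -> : (Negz 0 + 1 = Posz 0)%R by []; rewrite /= q10 q20; exact: w12.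
  by rewrite NegzS; apply: adj_sym; exact: adj1.
have countT : countable [set: V] by apply/countable_bijP; exists [set: nat].
have card_inf (X : set V) : infinite_set X -> (X #= [set: nat])%card.
  have leX : (X #<= [set: V])%card by apply: subset_card_le.
  exact: eq_card_nat (sub_countable leX countT).
have [W1 [f1 [sub1 deg1 inj1 surj1 ray1]]] := ray_labeling G V1 (card_inf _ inf1).
have [W2 [f2 [sub2 deg2 inj2 surj2 ray2]]] := ray_labeling G V2 (card_inf _ inf2).
(* [Negz] reverses the order, so descending paths in [V1] are increasing for [f1]. *)
pose phi v : int := if `[< V2 v >] then Posz (f2 v) else Negz (f1 v).
have not12 v : V1 v -> ~ V2 v.
  by move=> v1 v2; have : (V1 `&` V2) v by []; rewrite V12_0.
have V1E v : ~ V2 v -> V1 v.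
  by move=> nv2; have [] : (V1 `|` V2) v by rewrite V12.
have phi1 v : V1 v -> phi v = Negz (f1 v).
  by move=> /not12 nv2; rewrite /phi asboolF.
have phi2 v : V2 v -> phi v = Posz (f2 v) by move=> v2; rewrite /phi asboolT.
have neg v : (phi v < 0)%R -> V1 v.
  by move=> v0; apply: V1E => v2; move: v0; rewrite phi2.
have pos v : (0 <= phi v)%R -> V2 v.
  by move=> v0; apply: contrapT => /V1E v1; move: v0; rewrite phi1.
have phi_inj : injective phi.
  move=> u v; rewrite /phi; case: asboolP => u2; case: asboolP => v2 // -[].
    by apply: inj2; rewrite inE.
  by apply: inj1; rewrite inE; exact: V1E.
have exg i : exists v, phi v = i.
  case: i => n.
    by have [v v2 <-] := surj2 n; exists v; exact: phi2.
  by have [v v1 <-] := surj1 n; exists v; exact: phi1.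
have [g gK] := choice exg.
have [p [_ p_adj p_incr]] := paths phi (Bijective (inj_can_sym gK phi_inj) gK).
have mono i j : (i < j)%R -> (phi (p i) < phi (p j))%R.
  exact: (int_mono (phi \o p)).
have [k [k_neg k_pos]] := int_crossing (phi \o p) p_incr.
exists W1, W2; split=> //; exists (p k), (p (k + 1)%R); split=> //.
(* Read backwards from [k], the path is a ray in [V1] increasing for [f1], so it starts in [W1]. *)
- have neg_k i : (phi (p (k - i%:Z)) < 0)%R.
    apply: le_lt_trans k_neg; have [->|i0] := eqVneq i 0; first by rewrite subr0.
    by apply/ltW/mono; lia.
  rewrite -[k]subr0; apply: (ray1 (fun i => p (k - i%:Z)%R)) => i.
  + exact: neg.
  + have -> : (k - i%:Z = k - i.+1%:Z + 1)%R by lia.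
    by apply: adj_sym; exact: p_adj.
  + have : (phi (p (k - i.+1%:Z)) < phi (p (k - i%:Z)))%R by apply: mono; lia.
    by rewrite !phi1; [lia | exact: neg..].
- have pos_k i : (0 <= phi (p (k + 1 + i%:Z)))%R.
    apply: le_trans k_pos _; have [->|i0] := eqVneq i 0; first by rewrite addr0.
    by apply/ltW/mono; lia.
  rewrite -[(k + 1)%R]addr0; apply: (ray2 (fun i => p (k + 1 + i%:Z)%R)) => i.
  + exact: pos.
  + by have -> : (k + 1 + i.+1%:Z = k + 1 + i%:Z + 1)%R by lia.
  + have : (phi (p (k + 1 + i%:Z)) < phi (p (k + 1 + i.+1%:Z)))%R.
      by apply: mono; lia.
    by rewrite !phi2; [lia | exact: pos..].
Qed.
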